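(* Let $m\ge 4$ be an even integer and let $G$ be isomorphic to the dihedral group $D_{2m}=\langle a,b : a^m=b^2=1,\ bab^{-1}=a^{-1}\rangle$. Then the signless Laplacian spectrum of the non-commuting graph $\Gamma_G$ is $$\left\{(2m-4)^{\frac m2},\ (m)^{m-3},\ (2m-6)^{\frac m2-1},\ \left(2m-3+\sqrt{2m^2-8m+9}\right)^1,\ \left(2m-3-\sqrt{2m^2-8m+9}\right)^1\right\}$$ and its signless Laplacian energy is $$LE^+(\Gamma_G)=\begin{cases}\frac{m^3-4m^2+12}{2m-2}+2\sqrt{2m^2-8m+9}, & \text{if } 4\le m\le 8,\\[2pt] \frac{m^3-8m^2+16m-6}{m-1}+2\sqrt{2m^2-8m+9}, & \text{if } m\ge 10.\end{cases}$$
   Context: For a finite non-abelian group $G$ with center $Z(G)$, the non-commuting graph $\Gamma_G$ is the simple undirected graph with vertex set $G\setminus Z(G)$ in which $x,y$ are adjacent iff $xy\ne yx$. For a finite simple graph $\mathcal G$ with vertex set $v(\mathcal G)$, edge set $e(\mathcal G)$, adjacency matrix $A(\mathcal G)$ and diagonal degree matrix $D(\mathcal G)$, the signless Laplacian matrix is $Q(\mathcal G)=D(\mathcal G)+A(\mathcal G)$, and its signless Laplacian spectrum is the multiset of eigenvalues of $Q(\mathcal G)$. The notation $\{(\gamma_1)^{d_1},\dots,(\gamma_l)^{d_l}\}$ means the multiset in which $\gamma_r$ is listed $d_r$ times (coinciding listed values have their multiplicities added). The signless Laplacian energy is $LE^+(\mathcal G)=\sum_{\gamma}\left|\gamma-\frac{2|e(\mathcal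 G)|}{|v(\mathcal G)|}\right|$, the sum being over the signless Laplacian spectrum with multiplicity. *)

(* Defs.v *)
From HB Require Import structures.
From mathcomp Require Import all_boot all_order all_algebra all_fingroup.
From mathcomp Require Import all_solvable.

Set Implicit Arguments.
Unset Strict Implicit.
Unset Printing Implicit Defensive.

Import GRing.Theory Num.Theory.
Local Open Scope ring_scope.

Record simple_graph := SimpleGraph {
  vertex :> finType;
  adj : rel vertex;
  adj_sym : symmetric adj;
  adj_irr : irreflexive adj }.

Definition edges (Gr : simple_graph) : {set {set Gr}} :=
  [set e | [exists x, exists y, adj x y && (e == [set x; y])]].

Definition degree (Gr : simple_graph) (x : Gr) : nat := #|[set y | adj x y]|.

Section SignlessLaplacian.

(* C is any algebraically closed field with a norm, e.g. algC or the complex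
   numbers over a real closed field; all eigenvalues are taken in C. *)
Variables (C : numClosedFieldType) (Gr : simple_graph).

(* Rows and columns are indexed by the vertices through enum_val. *)
Definition adjacency_mx : 'M[C]_#|Gr| :=
  \matrix_(i, j) (adj (enum_val i) (enum_val j))%:R.

Definition degree_mx : 'M[C]_#|Gr| :=
  diag_mx (\row_i (degree (enum_val i))%:R).

Definition signless_laplacian : 'M[C]_#|Gr| := degree_mx + adjacency_mx.

End SignlessLaplacian.

(* The eigenvalues of A, each listed with its (algebraic) multiplicity: the
   roots s of the characteristic polynomial,
   char_poly A = \prod_(z <- s) ('X - z%:P).  The order of the list is
   irrelevant, multisets being compared with perm_eq. *)
Definition spectrum (C : numClosedFieldType) n (A : 'M[C]_n) : seq C :=
  sval (closed_field_poly_normal (char_poly A)).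

Lemma spectrumP (C : numClosedFieldType) n (A : 'M[C]_n) :
  char_poly A = \prod_(z <- spectrum A) ('X - z%:P).
Proof.
rewrite /spectrum; case: closed_field_poly_normal => s /= Ds.
by rewrite [LHS]Ds (monicP (char_poly_monic A)) scale1r.
Qed.

Definition signless_laplacian_spectrum (C : numClosedFieldType)
    (Gr : simple_graph) : seq C :=
  spectrum (signless_laplacian C Gr).

Definition signless_laplacian_energy (C : numClosedFieldType)
    (Gr : simple_graph) : C :=
  \sum_(z <- signless_laplacian_spectrum C Gr)
     `|z - (2 * #|edges Gr|)%:R / #|Gr|%:R|.

Section NonCommutingGraph.

Variables (gT : finGroupType) (G : {group gT}).

Definition noncentral : finType := {x : gT | x \in (G :\: 'Z(G))%g}.

Definition noncommuting : rel noncentral :=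
  fun x y => (val x * val y != val y * val x)%g.

Lemma noncommuting_sym : symmetric noncommuting.
Proof. by move=> x y; rewrite /noncommuting eq_sym. Qed.

Lemma noncommuting_irr : irreflexive noncommuting.
Proof. by move=> x; rewrite /noncommuting eqxx. Qed.

Definition noncommuting_graph : simple_graph :=
  SimpleGraph noncommuting_sym noncommuting_irr.

End NonCommutingGraph.

(* "G \isog Grp (...)" is the library's isomorphism with the (largest finite
   quotient of the) group given by a presentation; the group presented here is
   finite. *)
Definition is_dihedral (gT : finGroupType) (G : {group gT}) (m : nat) : Prop :=
  (G \isog Grp (a : b : a ^+ m, b ^+ 2, b * a * b^-1 = a^-1))%g.

(* Main.v *)
(* Order the vertices as: the reflections a^i b with i < h = m/2, the noncentral
   rotations, the reflections a^(i+h) b.  Two reflections commute iff their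
   exponents agree mod h, and a reflection commutes with no noncentral rotation,
   so the adjacency matrix consists of blocks 0, J and J - 1 (J all ones).  Adding
   and subtracting the two blocks of reflections splits off the eigenvalue 2m-4;
   the remaining 2 x 2 block determinant is computed by Schur complements, written
   without division so that it holds over the polynomial ring.  The mean degree
   comes from the handshake lemma, and the energy from the signs of the
   eigenvalues minus that mean. *)
Require Import Defs.
From HB Require Import structures.
From mathcomp Require Import all_boot all_order all_algebra all_fingroup.
From mathcomp Require Import all_solvable.
From mathcomp Require Import zify ring.

Set Implicit Arguments.
Unset Strict Implicit.
Unset Printing Implicit Defensive.

Import Order.TTheory GRing.Theory Num.Theory.
Local Open Scope ring_scope.

(** * Generators and relations of a dihedral group *)

Lemma sqr1_invg (gT : finGroupType) (b : gT) : (b ^+ 2 = 1)%g -> (b^-1 = b)%g.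
Proof. by move=> b2; apply/eqP; rewrite eq_invg_mul -expg2 b2. Qed.

(** The relations bound orders only from above: [a] has order at most m, [b] at most 2. Mapping G
    onto the dihedral group of order 2m bounds G from below, and together these force the order of
    [a]. *)
Lemma dihedral_gens (gT : finGroupType) (G : {group gT}) (m : nat) :
  (1 < m)%N -> is_dihedral G m ->
  exists a b : gT, [/\ #[a]%g = m, (b \notin <[a]>)%g, (b ^+ 2 = 1)%g,
     (a ^ b = a^-1)%g & (G :=: <[a]> * <[b]>)%g].
Proof.
move=> m_gt1 dG.
have [[a b] /= /eqP[defG am b2 ab]] := existsP (isoGrp_hom dG).
have {}ab : (a ^ b = a^-1)%g by rewrite -ab conjgE (sqr1_invg b2) mulgA.
(* The dihedral group of order 2m satisfies the presentation, so it is a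
   quotient of G; this bounds the order of G from below. *)
have DG : ('D_(m.*2) \homg G)%g.
  rewrite dG.
  have [[x y] /= /eqP[<- xm y2 xy]] := existsP (isoGrp_hom (Grp_dihedral m_gt1)).
  apply/existsP; exists (x, y); rewrite /= !xpair_eqE /= xm y2 !eqxx /=.
  by rewrite -xy conjgE (sqr1_invg y2) mulgA.
have nab : (<[b]> \subset 'N(<[a]>))%g.
  by rewrite cycle_subG; apply/normP; rewrite -genJ conjg_set1 ab; apply: cycleV.
have defG' : (G :=: <[a]> * <[b]>)%g by rewrite -defG norm_joinEr.
have G_ge : (m.*2 <= #|G|)%N.
  by rewrite -[X in (X <= _)%N](card_dihedral m_gt1) dvdn_leq ?cardG_gt0 ?card_homg.
have a_le : (#[a]%g <= m)%N by rewrite dvdn_leq ?order_dvdn ?am ?(ltnW m_gt1).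
have b_le : (#[b]%g <= 2)%N by rewrite dvdn_leq ?order_dvdn ?b2.
have Gab := mul_cardG <[a]> <[b]>; rewrite -defG' -!orderE in Gab.
have I_gt0 := cardG_gt0 (<[a]> :&: <[b]>)%g.
(* 2m <= |G| <= |<a>| |<b>| <= 2 |<a>|. *)
have oa : #[a]%g = m.
  apply/eqP; rewrite eqn_leq a_le /= -leq_double (leq_trans G_ge) //.
  by rewrite (leq_trans (leq_pmulr _ I_gt0)) // -Gab -muln2 leq_mul2l b_le orbT.
exists a, b; split=> //; apply/negP=> b_a.
have : (G \subset <[a]>)%g by rewrite defG' mul_subG // cycle_subG.
by move/subset_leq_card; rewrite -orderE oa; lia.
Qed.

(** * Commutation rules and enumeration of the noncentral elements *)

Lemma split_lshift m n (i : 'I_m) : split (lshift n i) = inl i.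
Proof. exact: (unsplitK (inl i)). Qed.

Lemma split_rshift m n (i : 'I_n) : split (rshift m i) = inr i.
Proof. exact: (unsplitK (inr i)). Qed.

Lemma not_dvd_bump h i : (i < h.-1.*2)%N -> (h %| bump h i.+1)%N = false.
Proof.
move=> lti; apply/negP=> /dvdnP[[|[|q]]]; rewrite /bump; move: lti; nia.
Qed.

Section DihedralVertices.

Variables (gT : finGroupType) (a b : gT) (h : nat).
Hypotheses (h_gt1 : (1 < h)%N) (ord_a : #[a]%g = h.*2) (b2 : (b ^+ 2 = 1)%g).
Hypotheses (ab : (a ^ b = a^-1)%g) (notab : (b \notin <[a]>)%g).

Lemma reflection_rotation i : (b * a ^+ i = (a ^+ i)^-1 * b)%g.
Proof. by rewrite -expgVn -ab -conjXg conjgE (sqr1_invg b2) -!mulgA -expg2 b2 mulg1. Qed.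

(** Conjugation by a reflection inverts rotations, so commuting means a^(2i) = 1, and [a] has order
    2h. *)
Lemma rotation_reflection_comm i j :
  (a ^+ i * (a ^+ j * b) == a ^+ j * b * a ^+ i)%g = (h %| i)%N.
Proof.
rewrite -mulgA reflection_rotation !mulgA (inj_eq (mulIg b)) -expgD addnC expgD.
rewrite (inj_eq (mulgI _)) eq_sym eq_invg_mul -expgD -order_dvdn ord_a.
by rewrite addnn -!muln2 dvdn_pmul2r.
Qed.

(** The two products are a^(i-j) and its inverse; they agree exactly when a^(2i) = a^(2j). *)
Lemma reflection_reflection_comm i j :
  (a ^+ i * b * (a ^+ j * b) == a ^+ j * b * (a ^+ i * b))%g = (i == j %[mod h]).
Proof.
have E u v : (a ^+ u * b * (a ^+ v * b) = a ^+ u * (a ^+ v)^-1)%g.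
  by rewrite mulgA -(mulgA (a ^+ u)%g) reflection_rotation -!mulgA -expg2 b2 mulg1.
have c : commute (a ^+ i)%g (a ^+ j)^-1%g by apply/commuteV/commuteX2.
have V : (a ^+ j * (a ^+ i)^-1 = (a ^+ i * (a ^+ j)^-1)^-1)%g by rewrite invgM invgK.
rewrite !E V eq_sym eq_invg_mul -expg2.
rewrite (expgMn _ c) expgVn -eq_mulgV1 -!expgM eq_expg_mod_order ord_a.
by rewrite -muln2 -!muln_modl eqn_pmul2r.
Qed.

(* Since i < m - 2, the exponent [bump h i.+1] runs over the numbers below m
   other than 0 and h, i.e. it skips the two central rotations. *)
Definition dihedral_vertex (i : 'I_(h + (h.-1.*2 + h))) : gT :=
  match split i with
  | inl i => a ^+ i * b
  | inr j => match split j with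
             | inl i => a ^+ bump h i.+1
             | inr i => a ^+ (i + h) * b
             end
  end%g.

Lemma dihedral_vertex_inj : injective dihedral_vertex.
Proof.
have powI i j : (i < h.*2)%N -> (j < h.*2)%N -> (a ^+ i = a ^+ j)%g -> i = j.
  move=> lti ltj /eqP; rewrite eq_expg_mod_order ord_a !modn_small //.
  by move/eqP.
have refI i j : (i < h.*2)%N -> (j < h.*2)%N -> (a ^+ i * b = a ^+ j * b)%g -> i = j.
  by move=> lti ltj /mulIg/powI; apply.
have rot_ref i j : (a ^+ i = a ^+ j * b)%g -> False.
  move=> E; case/negP: notab; rewrite -(groupMl _ (mem_cycle a j)) -E.
  exact: mem_cycle.
move=> i j; rewrite /dihedral_vertex.
case: (split_ordP i) => {i} i ->; case: (split_ordP j) => {j} j -> //=.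
- move/refI=> E; congr lshift; apply: val_inj; apply: E; move: (ltn_ord i) (ltn_ord j); lia.
- case: (split_ordP j) => k _; first by move/esym/rot_ref.
  by move/refI=> E; exfalso; move: (ltn_ord i) (ltn_ord k) E; lia.
- case: (split_ordP i) => k _; first by move/rot_ref.
  by move/refI=> E; exfalso; move: (ltn_ord k) (ltn_ord j) E; lia.
case: (split_ordP i) => {i} i ->; case: (split_ordP j) => {j} j ->.
- move/powI=> E; congr (rshift _ (lshift _ _)); apply: val_inj.
  apply: succn_inj; apply: (can_inj (bumpK h)).
  by apply: E; rewrite /bump; move: (ltn_ord i) (ltn_ord j); lia.
- by move/rot_ref.
- by move/esym/rot_ref.
move/refI=> E; congr (rshift _ (rshift _ _)); apply: val_inj.
by apply: (@addIn h); apply: E; move: (ltn_ord i) (ltn_ord j); lia.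
Qed.

Variable G : {group gT}.
Hypothesis defG : (G :=: <[a]> * <[b]>)%g.

Lemma rotation_in i : (a ^+ i)%g \in G.
Proof. by rewrite defG (subsetP (mulG_subl _ _)) ?mem_cycle. Qed.

Lemma reflection_in i : (a ^+ i * b)%g \in G.
Proof. by rewrite defG mem_mulg ?mem_cycle ?cycle_id. Qed.

Lemma dihedral_elem x : x \in G ->
  exists2 i, (i < h.*2)%N & (x = a ^+ i)%g \/ (x = a ^+ i * b)%g.
Proof.
have cyc c y : y \in <[c]>%g -> exists2 i, (i < #[c]%g)%N & (y = c ^+ i)%g.
  by case/cyclePmin=> i; exists i.
rewrite defG => /mulsgP[_ y /cyc[i lti ->] /cycleP[j ->] ->].
rewrite ord_a in lti; exists i => //.
rewrite (divn_eq j 2) expgD mulnC expgM b2 expg1n mul1g modn2.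
by case: (odd j); [right | left; rewrite mulg1].
Qed.

Lemma dihedral_vertex_noncentral i : dihedral_vertex i \in (G :\: 'Z(G))%g.
Proof.
have ref_nc j : (a ^+ j * b)%g \in (G :\: 'Z(G))%g.
  rewrite inE reflection_in andbT; apply/negP=> /centerP[_ /(_ a)].
  rewrite -[a in a \in _]expg1 rotation_in => /(_ isT)/esym/eqP.
  by rewrite -{1 3}[a]expg1 rotation_reflection_comm dvdn1 gtn_eqF.
rewrite /dihedral_vertex; case: split => // j; case: split => {}j //.
rewrite inE rotation_in andbT; apply/negP=> /centerP[_ /(_ b)].
rewrite -[b]mul1g -(expg0 a) reflection_in => /(_ isT)/eqP.
by rewrite rotation_reflection_comm not_dvd_bump.
Qed.

Lemma dihedral_vertex_surj x : x \in (G :\: 'Z(G))%g -> exists i, dihedral_vertex i = x.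
Proof.
case/setDP=> Gx; have [i lti [] ->] := dihedral_elem Gx => ncx; last first.
  case: (ltnP i h) => hi.
    by exists (lshift _ (Ordinal hi)); rewrite /dihedral_vertex split_lshift.
  have hi' : (i - h < h)%N by lia.
  exists (rshift _ (rshift _ (Ordinal hi'))).
  by rewrite /dihedral_vertex !split_rshift /= subnK.
have nhi : ~~ (h %| i)%N.
  apply: contra ncx => hi; apply/centerP; split=> [|y Gy]; first exact: rotation_in.
  have [j _ [] ->] := dihedral_elem Gy; first exact: commuteX2.
  by apply/eqP; rewrite rotation_reflection_comm.
(* [(unbump h i).-1] undoes [bump h i.+1] away from the central exponents 0 and [h]. *)
have hi : ((unbump h i).-1 < h.-1.*2)%N.
  move: nhi; case: (eqVneq i h) => [->|ih]; first by rewrite dvdnn.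
  by rewrite /unbump; case: (posnP i) => [->|]; rewrite ?dvdn0 //; lia.
exists (rshift _ (lshift _ (Ordinal hi))).
rewrite /dihedral_vertex split_rshift split_lshift /=.
congr (_ ^+ _)%g; move: nhi; case: (eqVneq i h) => [->|ih]; first by rewrite dvdnn.
by rewrite /bump /unbump; case: (posnP i) => [->|]; rewrite ?dvdn0 //; lia.
Qed.

End DihedralVertices.

(** * The adjacency matrix in block form *)

(** Among reflections, a^i b commutes only with itself and a^(i+h) b, so all four reflection blocks
    are J - 1, even off the diagonal; the block 0 is that of the mutually commuting rotations. *)
Definition dihedral_adjacency_mx (R : nzRingType) h : 'M[R]_(h + (h.-1.*2 + h)) :=
  block_mx (const_mx 1 - 1%:M) (row_mx (const_mx 1) (const_mx 1 - 1%:M))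
    (col_mx (const_mx 1) (const_mx 1 - 1%:M))
    (block_mx 0 (const_mx 1) (const_mx 1) (const_mx 1 - 1%:M)).

Lemma dihedral_adjacency (gT : finGroupType) (G : {group gT}) (h : nat) :
  (1 < h)%N -> is_dihedral G h.*2 ->
  exists2 f : 'I_(h + (h.-1.*2 + h)) -> noncommuting_graph G, bijective f &
    forall R : nzRingType,
    \matrix_(i, j) (adj (f i) (f j))%:R = dihedral_adjacency_mx R h.
Proof.
move=> h_gt1 dG; have m_gt1 : (1 < h.*2)%N by lia.
have [a [b [oa notab b2 ab defG]]] := dihedral_gens m_gt1 dG.
pose f i : noncommuting_graph G :=
  Sub (dihedral_vertex a b i) (dihedral_vertex_noncentral h_gt1 oa b2 ab defG i).
exists f.
  have f_inj : injective f.
    by move=> i j /(congr1 val) /(dihedral_vertex_inj h_gt1 oa notab).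
  have [|g fK] := @fin_all_exists _ _ (fun x i => f i = x).
    move=> x; have [i Di] := dihedral_vertex_surj h_gt1 oa b2 ab notab defG (valP x).
    by exists i; apply: val_inj.
  by exists g => // i; apply: f_inj; rewrite fK.
move=> R; have bE (c : bool) : (~~ c)%:R = 1 - c%:R :> R by case: c; rewrite ?subr0 ?subrr.
have ref_rot u v : (a ^+ u * b * a ^+ v == a ^+ v * (a ^+ u * b))%g = (h %| v)%N.
  by rewrite eq_sym (rotation_reflection_comm oa b2 ab).
have rot_rot u v : (a ^+ u * a ^+ v == a ^+ v * a ^+ u)%g by apply/eqP/commuteX2.
apply/matrixP=> i j; rewrite mxE /dihedral_adjacency_mx /= /noncommuting /= /dihedral_vertex.
case: (split_ordP i) => {}i ->; case: (split_ordP j) => {}j ->.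
- rewrite (reflection_reflection_comm oa b2 ab) !modn_small // bE.
  by rewrite block_mxEul !mxE.
- case: (split_ordP j) => {}j ->; rewrite block_mxEur ?row_mxEl ?row_mxEr !mxE.
    by rewrite ref_rot not_dvd_bump.
  by rewrite (reflection_reflection_comm oa b2 ab) modnDr !modn_small // bE.
- case: (split_ordP i) => {}i ->; rewrite block_mxEdl ?col_mxEu ?col_mxEd !mxE.
    by rewrite (rotation_reflection_comm oa b2 ab) not_dvd_bump.
  by rewrite (reflection_reflection_comm oa b2 ab) modnDr !modn_small // bE.
case: (split_ordP i) => {}i ->; case: (split_ordP j) => {}j ->; rewrite block_mxEdr.
- by rewrite block_mxEul rot_rot mxE.
- by rewrite block_mxEur (rotation_reflection_comm oa b2 ab) not_dvd_bump // mxE.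
- by rewrite block_mxEdl ref_rot not_dvd_bump // mxE.
rewrite (reflection_reflection_comm oa b2 ab) !modnDr !modn_small // bE.
by rewrite block_mxEdr !mxE.
Qed.

(** * Independence of the vertex numbering, and the handshake lemma *)

(** Rows and columns undergo the same permutation, so its sign enters twice and cancels. *)
Lemma char_poly_reindex (R : comNzRingType) n p (A : 'M[R]_n) (B : 'M_p)
    (f : 'I_n -> 'I_p) :
  bijective f -> (forall i j, A i j = B (f i) (f j)) -> char_poly A = char_poly B.
Proof.
move=> f_bij; have := bij_eq_card f_bij; rewrite !card_ord => np.
subst p => AB; pose s := perm (bij_inj f_bij).
rewrite /char_poly; have -> : char_poly_mx A = row_perm s (col_perm s (char_poly_mx B)).
  by apply/matrixP=> i j; rewrite !mxE !permE AB (inj_eq (bij_inj f_bij)).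
rewrite row_permE col_permE !det_mulmx !det_perm mulrCA -signr_addb.
by rewrite odd_permV addbb mulr1.
Qed.

(** Double counting of ordered adjacent pairs: an edge {x, y} comes from exactly (x, y) and (y, x),
    which differ because there are no loops. *)
Lemma handshake (Gr : simple_graph) : (\sum_(x : Gr) degree x = 2 * #|edges Gr|)%N.
Proof.
transitivity (\sum_(p : Gr * Gr | adj p.1 p.2) 1)%N.
  rewrite -(pair_big_dep xpredT (@adj Gr) (fun _ _ => 1%N)) /=.
  by apply: eq_bigr => x _; rewrite /degree sum1dep_card.
rewrite (partition_big (fun p : Gr * Gr => [set p.1; p.2]) (mem (edges Gr))) /=; last first.
  move=> [x y] /= xy; rewrite inE; apply/existsP; exists x; apply/existsP; exists y.
  by rewrite xy eqxx.
rewrite mulnC -sum_nat_const; apply: eq_bigr => e.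
rewrite inE => /existsP[x /existsP[y /andP[xy /eqP->]]].
have xNy : x != y by apply/eqP=> E; rewrite E adj_irr in xy.
rewrite sum1dep_card -[RHS](_ : #|[set (x, y); (y, x)]| = 2)%N; last first.
  by rewrite cards2 xpair_eqE (negPf xNy).
apply: eq_card => -[u v]; rewrite !inE /= !xpair_eqE.
apply/andP/orP=> [[uv /eqP E] | [] /andP[/eqP-> /eqP->]]; last 2 first.
- by [].
- by rewrite adj_sym setUC.
have uNv : u != v by apply/eqP=> E'; rewrite E' adj_irr in uv.
move: (set21 u v) (set22 u v) uNv; rewrite E !inE.
by case/orP=> /eqP-> /orP[] /eqP->; rewrite ?eqxx; [|left|right|].
Qed.

(** * Determinants of block matrices with scalar and constant blocks *)

(* Schur complement of c%:M, multiplied out so that c need not be invertible. *)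
Lemma det_block_scalar (R : comNzRingType) n q (c : R) (U : 'M_(n, q)) V (D : 'M_q) :
  c ^+ q * \det (block_mx c%:M U V D) = c ^+ n * \det (c *: D - V *m U).
Proof.
have := det_mulmx (block_mx c%:M U V D) (block_mx 1%:M (- U) 0 c%:M).
rewrite det_ublock det1 mul1r det_scalar mulrC => <-.
rewrite mulmx_block !mulmx1 !mulmx0 !addr0 !mulmxN mul_scalar_mx mul_mx_scalar.
rewrite [X in block_mx _ X]addrC subrr det_lblock det_scalar mul_mx_scalar.
by rewrite [X in \det X]addrC.
Qed.

Lemma det_block_1 (R : comNzRingType) n q (A : 'M[R]_n) (U : 'M_(n, q)) V :
  \det (block_mx A U V 1%:M) = \det (A - U *m V).
Proof.
have := det_mulmx (block_mx A U V 1%:M) (block_mx 1%:M 0 (- V) 1%:M).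
rewrite det_lblock !det1 !mulr1 => <-.
rewrite mulmx_block !mulmx1 !mulmx0 !add0r mulmxN mul1mx subrr.
by rewrite det_ublock det1 mulr1.
Qed.

(** The constant matrix is a column times a row. One Schur complement turns these into borders, the
    opposite one leaves a 1 x 1 determinant; the extra factor [c] cancels. *)
Lemma det_scalar_sub_const (R : idomainType) n (c d : R) : c != 0 ->
  \det (c%:M - const_mx d : 'M_n.+1) = c ^+ n * (c - d *+ n.+1).
Proof.
move=> c0; apply: (mulfI c0).
have -> : const_mx d = (const_mx d : 'M_(n.+1, 1)) *m const_mx 1 :> 'M_n.+1.
  by apply/matrixP=> i j; rewrite !mxE big_ord1 !mxE mulr1.
rewrite -det_block_1 -[c in LHS]expr1 det_block_scalar mulrA -exprS; congr (_ * _).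
rewrite det_mx11 !mxE mulr1; congr (_ - _).
by rewrite (eq_bigr (fun=> d)) ?sumr_const ?card_ord // => i _; rewrite !mxE mul1r.
Qed.

Lemma det_quotient_block (R : idomainType) k h (x y : R) : x != 0 -> y != 0 ->
  x * \det (block_mx (x%:M : 'M_k) (const_mx (- 2)) (const_mx (- 1))
          (y%:M - const_mx 2 : 'M_h.+1)) =
  x ^+ k * y ^+ h * (x * y - (2 * x + 2 * k%:R) * h.+1%:R).
Proof.
(* The factor x^h completes the power x^(h+1) that [det_block_scalar] requires. *)
move=> x0 y0; apply: (mulfI (expf_neq0 h x0)).
rewrite mulrA -exprSr det_block_scalar.
have -> : x *: (y%:M - const_mx 2) - const_mx (- 1) *m (const_mx (- 2) : 'M_(k, _)) =
          (x * y)%:M - const_mx (2 * x + 2 * k%:R) :> 'M_h.+1.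
  apply/matrixP=> i j; rewrite !mxE (eq_bigr (fun=> 2)); last first.
    by move=> l _; rewrite !mxE mulrNN mul1r.
  by rewrite sumr_const card_ord mulrBr -mulrnAr -[2 *+ k]mulr_natr; ring.
rewrite det_scalar_sub_const ?mulf_neq0 // exprMn -mulr_natr; ring.
Qed.

(** The shape of X - Q for the dihedral graph. Differences of paired reflections contribute (z -
    1)^(h+1); their sums leave the matrix of [det_quotient_block] with y = z + 1. *)
Lemma det_paired_block (R : idomainType) k h (x z : R) : x != 0 -> z + 1 != 0 ->
  x * \det (block_mx (z%:M - const_mx 1) (row_mx (const_mx (- 1)) (1%:M - const_mx 1))
        (col_mx (const_mx (- 1)) (1%:M - const_mx 1))
        (block_mx (x%:M : 'M_k) (const_mx (- 1)) (const_mx (- 1))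
           (z%:M - const_mx 1 : 'M_h.+1))) =
  (z - 1) ^+ h.+1 * x ^+ k * (z + 1) ^+ h *
    (x * (z + 1) - (2 * x + 2 * k%:R) * h.+1%:R).
Proof.
move=> x0 z0; set M := block_mx _ _ _ _.
(* Subtract the last block row from the first, then add the first block column
   to the last: the result is block lower triangular. *)
pose L : 'M[R]_(h.+1 + (k + h.+1)) := block_mx 1%:M (row_mx 0 (- 1%:M)) 0 1%:M.
pose N : 'M[R]_(h.+1 + (k + h.+1)) := block_mx 1%:M (row_mx 0 1%:M) 0 1%:M.
have dL : \det L = 1 by rewrite det_ublock !det1 mulr1.
have dN : \det N = 1 by rewrite det_ublock !det1 mulr1.
have -> : \det M = \det (L *m M *m N) by rewrite !det_mulmx dL dN mulr1 mul1r.
rewrite /M /L /N !mulmx_block !mul0mx !mul1mx !mulmx1 !mulmx0 !add0r !addr0.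
rewrite mul_row_col mul_row_block !mul0mx !add0r !mulNmx !mul1mx.
rewrite add_row_mx mul_mx_row mulmx0 mulmx1 add_row_mx.
rewrite subrr addr0 -[X in row_mx 0 (_ + X)]opprB subrr row_mx0.
rewrite opprB addrA subrK -raddfB /= det_lblock det_scalar mul_col_row !mulmx0 !mulmx1.
rewrite add_block_mx !add0r.
have -> : const_mx (- 1) + const_mx (- 1) = const_mx (- 2) :> 'M[R]_(k, h.+1).
  by apply/matrixP=> i j; rewrite !mxE; ring.
have -> : 1%:M - const_mx 1 + (z%:M - const_mx 1) = (z + 1)%:M - const_mx 2 :> 'M_h.+1.
  apply/matrixP=> i j; rewrite !mxE.
  by rewrite -mulr_natr -[z *+ _]mulr_natr -[(z + 1) *+ _]mulr_natr; ring.
by rewrite mulrCA det_quotient_block // !mulrA.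
Qed.

(** * Characteristic polynomial of the dihedral signless Laplacian *)

(** These are the vertex degrees: a reflection fails to commute with 2h - 2 rotations and 2h - 2
    reflections, a noncentral rotation with all 2h reflections. *)
Lemma dihedral_adjacency_row_sum (R : comNzRingType) (h : nat) : (1 < h)%N ->
  dihedral_adjacency_mx R h *m const_mx 1 =
  col_mx (const_mx (4 * h%:R - 4))
    (col_mx (const_mx (2 * h%:R)) (const_mx (4 * h%:R - 4))) :> 'cV[R]_(h + (h.-1.*2 + h)).
Proof.
move=> h_gt1.
have JE m n : (const_mx 1 : 'M_(m, n)) *m const_mx 1 = const_mx n%:R :> 'cV[R]_m.
  apply/matrixP=> i j; rewrite !mxE (eq_bigr (fun=> 1)) ?sumr_const ?card_ord //.
  by move=> l _; rewrite !mxE mulr1.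
have kE : h.-1.*2%:R = 2 * h%:R - 2 :> R.
  have -> : h.-1.*2 = (h.*2 - 2)%N by lia.
  by rewrite natrB -?muln2 ?natrM 1?mulrC //; lia.
have -> : const_mx 1 = col_mx (const_mx 1) (col_mx (const_mx 1) (const_mx 1))
    :> 'cV[R]_(h + (h.-1.*2 + h)) by rewrite !col_mx_const.
rewrite mul_block_col mul_row_col mul_col_mx mul_block_col.
rewrite !mulmxBl !mul1mx !JE mul0mx kE !add_col_mx.
congr col_mx; last congr col_mx; apply/matrixP=> i j; rewrite !mxE; ring.
Qed.

Lemma char_poly_dihedral_mx (R : idomainType) p (A := dihedral_adjacency_mx R p.+2) :
  char_poly (diag_mx (A *m const_mx 1)^T + A) =
  ('X - (4 * p%:R + 4)%:P) ^+ p.+2 * ('X - (2 * p%:R + 4)%:P) ^+ p.*2.+1 *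
  ('X - (4 * p%:R + 2)%:P) ^+ p.+1 *
  ('X ^+ 2 - (8 * p%:R + 10) *: 'X + (8 * p%:R ^+ 2 + 24 * p%:R + 16)%:P).
Proof.
pose x : {poly R} := 'X - (2 * p%:R + 4)%:P.
(* A reflection has degree 4p + 4; the constant drops by one because -(J - 1) puts 1 back on the
   diagonal. *)
pose z : {poly R} := 'X - (4 * p%:R + 3)%:P.
have x0 : x != 0 by rewrite polyXsubC_eq0.
have z1E : z + 1 = 'X - (4 * p%:R + 2)%:P by rewrite /z !polyCD; ring.
have zm1E : z - 1 = 'X - (4 * p%:R + 4)%:P by rewrite /z !polyCD; ring.
have z10 : z + 1 != 0 by rewrite z1E polyXsubC_eq0.
apply: (mulfI x0); rewrite /char_poly.
have -> : char_poly_mx (diag_mx (A *m const_mx 1)^T + A) =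
   block_mx (z%:M - const_mx 1) (row_mx (const_mx (- 1)) (1%:M - const_mx 1))
        (col_mx (const_mx (- 1)) (1%:M - const_mx 1))
        (block_mx (x%:M : 'M_(p.+1.*2)) (const_mx (- 1)) (const_mx (- 1))
           (z%:M - const_mx 1 : 'M_p.+2)).
  rewrite /char_poly_mx /A dihedral_adjacency_row_sum // !tr_col_mx !diag_mx_row.
  rewrite /dihedral_adjacency_mx !add_block_mx !add0r !map_block_mx map_row_mx map_col_mx.
  rewrite scalar_mx_block opp_block_mx add_block_mx !add0r opp_row_mx opp_col_mx.
  rewrite [X in block_mx _ _ _ (X + _)]scalar_mx_block opp_block_mx add_block_mx.
  have pE : p.+2%:R = p%:R + 2 :> R by rewrite -addn2 natrD.
  have NJ m n : - map_mx polyC (const_mx 1 : 'M[R]_(m, n)) = const_mx (- 1).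
    by apply/matrixP=> i j; rewrite !mxE.
  have -> : 'X%:M - map_mx polyC (diag_mx (const_mx (4 * p.+2%:R - 4))^T
              + (const_mx 1 - 1%:M)) = z%:M - const_mx 1 :> 'M_p.+2.
    rewrite trmx_const diag_const_mx map_mxD map_mxB map_mx1 map_scalar_mx map_const_mx /=.
    rewrite opprD opprB !addrA -raddfB -raddfD /=; congr (_%:M - _).
    by rewrite /z pE; ring.
  have -> : - map_mx polyC (const_mx 1 - 1%:M : 'M[R]_p.+2) = 1%:M - const_mx 1.
    by rewrite map_mxB map_mx1 map_const_mx opprB.
  rewrite !NJ !add0r addr0 trmx_const diag_const_mx map_scalar_mx -raddfB /=.
  rewrite /x pE; congr (block_mx _ _ _ (block_mx _%:M _ _ _)); ring.
(* One [x] is split off x^(2p+2) to match the factor put on both sides, leaving the exponent 2p + 1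
   = m - 3. *)
rewrite det_paired_block // z1E zm1E -/x (exprS x).
have -> : x * ('X - (4 * p%:R + 2)%:P) - (2 * x + 2 * p.+2.-1.*2%:R) * p.+2%:R =
    'X ^+ 2 - (8 * p%:R + 10) *: 'X + (8 * p%:R ^+ 2 + 24 * p%:R + 16)%:P.
  by rewrite /x -mul_polyC /= -[p.+2]addn2 -addn1 -muln2; ring.
by move: (('X - (4 * p%:R + 4)%:P) ^+ p.+2) => P; rewrite (mulrCA P x) -!(mulrA x).
Qed.

(** * From a graph to its matrix in an arbitrary vertex numbering *)

Section Reindex.

Variables (C : numClosedFieldType) (Gr : simple_graph) (n : nat) (f : 'I_n -> Gr).
Hypothesis f_bij : bijective f.

Let A : 'M[C]_n := \matrix_(i, j) (adj (f i) (f j))%:R.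

Lemma degree_reindex i : (degree (f i))%:R = (A *m const_mx 1 : 'cV_n) i 0.
Proof.
rewrite mxE /degree -sum1dep_card big_mkcond /= natr_sum (reindex f); last exact: onW_bij.
by apply: eq_bigr => j _; rewrite !mxE mulr1; case: adj.
Qed.

Lemma char_poly_signless_laplacian :
  char_poly (signless_laplacian C Gr) = char_poly (diag_mx (A *m const_mx 1)^T + A).
Proof.
apply/esym/(char_poly_reindex (f := enum_rank \o f)).
  by apply: bij_comp f_bij; apply: enum_rank_bij.
move=> i j; rewrite /signless_laplacian !mxE !enum_rankK.
congr (_ *+ _ + _); last by rewrite (inj_eq (bij_inj (bij_comp (@enum_rank_bij _) f_bij))).
by rewrite degree_reindex mxE.
Qed.

Lemma edges_reindex : (2 * #|edges Gr|)%:R = \sum_i (A *m const_mx 1 : 'cV_n) i 0.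
Proof.
rewrite -handshake (reindex f); last exact: onW_bij.
by rewrite natr_sum; apply: eq_bigr => i _; rewrite degree_reindex.
Qed.

Lemma card_reindex : #|Gr| = n.
Proof. by rewrite -(bij_eq_card f_bij) card_ord. Qed.

End Reindex.

(** * Spectrum, mean degree and energy in terms of p *)

(* Writing m = 2(p + 2) turns m - 3 and m/2 - 1 into 2p + 1 and p + 1, without
   truncated subtraction. *)
Section DihedralSpectrum.

Variables (C : numClosedFieldType) (gT : finGroupType) (G : {group gT}) (p : nat).
Hypothesis G_dihedral : is_dihedral G p.+2.*2.

Let y : C := p%:R.

(** At m = 2y + 4 the radicand 2m^2 - 8m + 9 becomes 8y^2 + 16y + 9. The last two values are the
    roots of the quadratic factor, so either square root [s] will do. *)
Lemma noncommuting_dihedral_spectrum (s : C) :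
  s ^+ 2 = 8 * y ^+ 2 + 16 * y + 9 ->
  perm_eq (signless_laplacian_spectrum C (noncommuting_graph G))
    (nseq p.+2 (4 * y + 4) ++ nseq p.*2.+1 (2 * y + 4) ++ nseq p.+1 (4 * y + 2) ++
     [:: 4 * y + 5 + s; 4 * y + 5 - s]).
Proof.
move=> s2; have [//|f f_bij fE] := dihedral_adjacency _ G_dihedral.
apply: prod_XsubC_eq; rewrite -spectrumP (char_poly_signless_laplacian C f_bij) fE.
rewrite char_poly_dihedral_mx !big_cat !big_nseq !iter_mulr_1 big_cons big_seq1.
rewrite -2!mulrA; congr (_ * (_ * (_ * _))).
have -> : 8 * p%:R ^+ 2 + 24 * p%:R + 16 = (4 * y + 5) ^+ 2 - s ^+ 2.
  by rewrite s2 /y; ring.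
by rewrite -mul_polyC /y /=; ring.
Qed.

(** With h = p + 2, the degree sum 2h(4h - 4) + (2h - 2)2h = 12h(h - 1) is shared by 4h - 2
    vertices. *)
Lemma noncommuting_dihedral_mean_degree :
  (2 * #|edges (noncommuting_graph G)|)%:R / #|noncommuting_graph G|%:R =
  6 * (y + 1) * (y + 2) / (2 * y + 3) :> C.
Proof.
have [//|f f_bij fE] := dihedral_adjacency _ G_dihedral.
rewrite (edges_reindex C f_bij) (card_reindex f_bij) fE dihedral_adjacency_row_sum //.
rewrite big_split_ord big_split_ord /=.
rewrite (eq_bigr (fun=> 4 * p.+2%:R - 4)) => [|i _]; last by rewrite col_mxEu mxE.
rewrite [X in _ + (X + _)](eq_bigr (fun=> 2 * p.+2%:R)) => [|i _]; last first.
  by rewrite col_mxEd col_mxEu mxE.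
rewrite [X in _ + (_ + X)](eq_bigr (fun=> 4 * p.+2%:R - 4)) => [|i _]; last first.
  by rewrite !col_mxEd mxE.
rewrite !sumr_const !card_ord.
have y0 : 0 <= y by apply: ler0n.
have D0 : 2 * y + 3 != 0 by rewrite lt0r_neq0 // ltr_wpDl ?mulr_ge0 ?ler0n ?ltr0n.
have E0 : 4 * y + 6 != 0 by rewrite lt0r_neq0 // ltr_wpDl ?mulr_ge0 ?ler0n ?ltr0n.
have -> : (p.+2 + (p.+2.-1.*2 + p.+2) = 4 * p + 6)%N by lia.
have -> : (4 * p + 6)%:R = 4 * y + 6 by rewrite /y; ring.
rewrite -muln2.
by rewrite /y in D0 E0 *; field; rewrite D0 E0.
Qed.

(** Only the deviation of the eigenvalue 4y + 2 has a sign that varies with [p], hence the one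
    remaining absolute value. *)
Lemma noncommuting_dihedral_energy (s : C) :
  0 <= s -> s ^+ 2 = 8 * y ^+ 2 + 16 * y + 9 ->
  signless_laplacian_energy C (noncommuting_graph G) =
  ((y + 2) * (2 * y ^+ 2 + 2 * y) + (2 * y + 1) * (2 * y ^+ 2 + 4 * y) +
   (y + 1) * `|2 * y ^+ 2 - 2 * y - 6|) / (2 * y + 3) + 2 * s.
Proof.
move=> s0 s2; rewrite /signless_laplacian_energy noncommuting_dihedral_mean_degree.
rewrite (perm_big _ (noncommuting_dihedral_spectrum s2)) !big_cat !big_nseq !iter_addr_0.
rewrite big_cons big_seq1.
have y0 : 0 <= y by apply: ler0n.
have D0 : 0 < 2 * y + 3 by rewrite ltr_wpDl ?mulr_ge0 ?ler0n ?ltr0n.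
have Dn0 := lt0r_neq0 D0.
have -> : 4 * y + 4 - 6 * (y + 1) * (y + 2) / (2 * y + 3) =
          (2 * y ^+ 2 + 2 * y) / (2 * y + 3) by field.
have -> : 2 * y + 4 - 6 * (y + 1) * (y + 2) / (2 * y + 3) =
          - ((2 * y ^+ 2 + 4 * y) / (2 * y + 3)) by field.
have -> : 4 * y + 2 - 6 * (y + 1) * (y + 2) / (2 * y + 3) =
          (2 * y ^+ 2 - 2 * y - 6) / (2 * y + 3) by field.
(* [q] is 4y + 5 minus the mean; once q <= s, the last two eigenvalues contribute (q + s) + (s - q)
   = 2s. *)
pose q := (2 * y ^+ 2 + 4 * y + 3) / (2 * y + 3).
have q0 : 0 <= q by rewrite divr_ge0 ?addr_ge0 ?mulr_ge0 ?exprn_ge0 ?ler0n.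
have qs : q <= s.
  (* Squares are compared; after clearing the denominator the difference has only positive
     coefficients. *)
  rewrite -(@ler_pXn2r _ 2) ?nnegrE // s2 expr_div_n ler_pdivrMr ?exprn_gt0 //.
  rewrite -subr_ge0.
  have -> : (8 * y ^+ 2 + 16 * y + 9) * (2 * y + 3) ^+ 2 - (2 * y ^+ 2 + 4 * y + 3) ^+ 2
     = 28 * y ^+ 4 + 144 * y ^+ 3 + 272 * y ^+ 2 + 228 * y + 72 by ring.
  by rewrite ?addr_ge0 ?mulr_ge0 ?exprn_ge0 ?ler0n.
have -> : 4 * y + 5 + s - 6 * (y + 1) * (y + 2) / (2 * y + 3) = q + s by rewrite /q; field.
have -> : 4 * y + 5 - s - 6 * (y + 1) * (y + 2) / (2 * y + 3) = - (s - q).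
  by rewrite /q; field.
have a0 : 0 <= 2 * y ^+ 2 + 2 * y by rewrite addr_ge0 ?mulr_ge0 ?exprn_ge0 ?ler0n.
have b0 : 0 <= 2 * y ^+ 2 + 4 * y by rewrite addr_ge0 ?mulr_ge0 ?exprn_ge0 ?ler0n.
rewrite !normrN !normf_div (ger0_norm (ltW D0)) (ger0_norm (addr_ge0 q0 s0)).
rewrite (ger0_norm a0) (ger0_norm b0) (@ger0_norm _ (s - q)) ?subr_ge0 //.
rewrite -muln2 /q; move: `|_| => t /=.
by move: Dn0; rewrite /y => Dn0; field.
Qed.

End DihedralSpectrum.

(** * Return from p to m, with the sign change between m = 8 and m = 10 *)

Theorem theorem2p3 (C : numClosedFieldType) (gT : finGroupType)
    (G : {group gT}) (m : nat) (m_ge4 : (4 <= m)%N) (m_even : ~~ odd m)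
    (G_dihedral : is_dihedral G m) :
  let x : C := m%:R in
  let s : C := sqrtC (2 * x ^+ 2 - 8 * x + 9) in
  perm_eq (signless_laplacian_spectrum C (noncommuting_graph G))
    (nseq (m %/ 2) (2 * x - 4) ++ nseq (m - 3) x ++
     nseq (m %/ 2 - 1) (2 * x - 6) ++ [:: 2 * x - 3 + s; 2 * x - 3 - s])
  /\ ((4 <= m <= 8)%N ->
        signless_laplacian_energy C (noncommuting_graph G) =
          (x ^+ 3 - 4 * x ^+ 2 + 12) / (2 * x - 2) + 2 * s)
  /\ ((10 <= m)%N ->
        signless_laplacian_energy C (noncommuting_graph G) =
          (x ^+ 3 - 8 * x ^+ 2 + 16 * x - 6) / (x - 1) + 2 * s).
Proof.
have [p Dm] : exists p, m = p.+2.*2 by exists (m./2 - 2)%N; lia.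
move=> {m_ge4 m_even} x s; subst m.
pose y : C := p%:R.
have y0 : 0 <= y by apply: ler0n.
have xE : x = 2 * y + 4 by rewrite /x /y -muln2 -addn2; ring.
have s2E : 2 * x ^+ 2 - 8 * x + 9 = 8 * y ^+ 2 + 16 * y + 9 by rewrite xE; ring.
have s2 : s ^+ 2 = 8 * y ^+ 2 + 16 * y + 9 by rewrite sqrtCK.
have s0 : 0 <= s by rewrite sqrtC_ge0 s2E ?addr_ge0 ?mulr_ge0 ?exprn_ge0 ?ler0n.
have D0 : 2 * y + 3 != 0 by rewrite lt0r_neq0 // ltr_wpDl ?mulr_ge0 ?ler0n ?ltr0n.
split; [|split=> m_bound; rewrite (noncommuting_dihedral_energy G_dihedral s0 s2)].
- have -> : (p.+2.*2 %/ 2 - 1 = p.+1)%N by lia.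
  have -> : (p.+2.*2 %/ 2 = p.+2)%N by lia.
  have -> : (p.+2.*2 - 3 = p.*2.+1)%N by lia.
  have -> : 2 * x - 4 = 4 * y + 4 by rewrite xE; ring.
  have -> : 2 * x - 6 = 4 * y + 2 by rewrite xE; ring.
  have -> : 2 * x - 3 = 4 * y + 5 by rewrite xE; ring.
  rewrite xE; exact: noncommuting_dihedral_spectrum.
- have -> : `|2 * p%:R ^+ 2 - 2 * p%:R - 6| = - (2 * y ^+ 2 - 2 * y - 6).
    rewrite ler0_norm // -oppr_ge0.
    (* m <= 8 means p <= 2, where the polynomial takes the values -6, -6, -2. *)
    have [k kE] : exists k, 2 * y ^+ 2 - 2 * y - 6 = - k%:R.
      have : p \in [:: 0; 1; 2]%N by rewrite !inE; lia.
      rewrite /y !inE => /or3P[]/eqP->; [exists 6%N | exists 6%N | exists 2%N]; ring.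
    by rewrite -/y kE opprK ler0n.
  rewrite xE -/y.
  have -> : 2 * (2 * y + 4) - 2 = 2 * (2 * y + 3) by ring.
  by congr (_ + _); field.
rewrite -/y ger0_norm.
  have -> : x - 1 = 2 * y + 3 by rewrite xE; ring.
  by rewrite xE; congr (_ + _); field.
(* m >= 10 means p >= 3; in r = p - 3 the polynomial has only positive coefficients. *)
have [r Dp] : exists r, p = (r + 3)%N by exists (p - 3)%N; lia.
have -> : 2 * y ^+ 2 - 2 * y - 6 = (2 * r ^ 2 + 10 * r + 6)%:R by rewrite /y Dp; ring.
exact: ler0n.
Qed.
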